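(* Let $0<\alpha<1$, $\beta\in(0,1]$, $\gamma\in(1,2]$, $a<b$, $T>0$, let $d_\pm,e_\pm$ be non-negative real functions on $[a,b]\times[0,T]$, let $f$ and $\phi$ be given, and let $u$ be an exact solution of the space-time fractional advection-diffusion initial-boundary value problem described in the context. For integers $m\ge2$, $n\ge1$ let $u_i^{(k)}$, $i=1,\dots,m-1$, $k=1,\dots,n$, be the numerical solution computed by the implicit difference method described in the context. Assume that the local truncation errors $R_i^{(k+1)}$ defined in the context satisfy $R_i^{(k+1)}=\mathcal{O}(\tau^2+\tau^\alpha h)$ uniformly, i.e. there is a constant $C_0>0$, independent of $m,n,i,k$, with $|R_i^{(k+1)}|\le C_0(\tau^2+\tau^\alpha h)$ for all $1\le i\le m-1$, $0\le k\le n-1$. Then there exists a constant $C$, independent of $m,n,i,k$, such that $$|u(x_i,t_k)-u_i^{(k)}|\le C(\tau^{2-\alpha}+h),\qquad i=1,\dots,m-1;\ k=1,\dots,n .$$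
   Context: The problem. $u$ satisfies, for $a<x<b$, $0<t\le T$, $$\frac{\partial^\alpha u}{\partial t^\alpha}=-d_+D^\beta_{a,x}u-d_-D^\beta_{x,b}u+e_+D^\gamma_{a,x}u+e_-D^\gamma_{x,b}u+f,$$ with coefficients $d_\pm(x,t),e_\pm(x,t)$ and source $f(x,t)$, $u(x,0)=\phi(x)$ for $a\le x\le b$, and $u(a,t)=u(b,t)=0$ for $0<t\le T$. Here the time derivative is the Caputo derivative $\frac{\partial^\alpha u(x,t)}{\partial t^\alpha}=\frac1{\Gamma(1-\alpha)}\int_0^t\frac{\partial u(x,s)}{\partial s}\frac{ds}{(t-s)^\alpha}$, and for order $\theta$ with integer $p$, $p-1<\theta\le p$, the Riemann-Liouville derivatives are $D^\theta_{a,x}u=\frac1{\Gamma(p-\theta)}\frac{\partial^p}{\partial x^p}\int_a^x\frac{u(s,t)}{(x-s)^{\theta-p+1}}ds$ and $D^\theta_{x,b}u=\frac{(-1)^p}{\Gamma(p-\theta)}\frac{\partial^p}{\partial x^p}\int_x^b\frac{u(s,t)}{(s-x)^{\theta-p+1}}ds$ (for integer $\theta=p$ these are understood as the classical derivatives $\frac{\partial^p u}{\partial x^p}$ and $(-1)^p\frac{\partial^p u}{\partial x^p}$). Notation. $h=(b-a)/m$, $\tau=T/n$, $x_i=a+ih$ ($0\le i\le m$), $t_j=j\tau$ ($0\le j\le n$). $d_{\pm,i}^{(j)}=d_\pm(x_i,t_j)$, $e_{\pm,i}^{(j)}=e_\pm(x_i,t_j)$, $f_i^{(j)}=f(x_i,t_j)$.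 $a_0=1$ and $a_j=(j+1)^{1-\alpha}-j^{1-\alpha}$. For $\theta\in\{\beta,\gamma\}$: $g_0^{(\theta)}=1$, $g_j^{(\theta)}=\frac{(-1)^j}{j!}\theta(\theta-1)\cdots(\theta-j+1)$ for $j\ge1$. $\omega_1=\Gamma(2-\alpha)\tau^\alpha/h^\beta$, $\omega_2=\Gamma(2-\alpha)\tau^\alpha/h^\gamma$, $\omega_3=\Gamma(2-\alpha)\tau^\alpha$. For a grid function $v_i^{(k)}$ ($0\le i\le m$, $0\le k\le n$) write $$(Lv)_i^{(k+1)}=v_i^{(k+1)}+\omega_1\Big(d_{+,i}^{(k+1)}\sum_{j=0}^{i}g_j^{(\beta)}v_{i-j}^{(k+1)}+d_{-,i}^{(k+1)}\sum_{j=0}^{m-i}g_j^{(\beta)}v_{i+j}^{(k+1)}\Big)-\omega_2\Big(e_{+,i}^{(k+1)}\sum_{j=0}^{i+1}g_j^{(\gamma)}v_{i-j+1}^{(k+1)}+e_{-,i}^{(k+1)}\sum_{j=0}^{m-i+1}g_j^{(\gamma)}v_{i+j-1}^{(k+1)}\Big).$$ The implicit difference method: $(Lu)_i^{(k+1)}=u_i^{(k)}-\sum_{j=1}^{k}a_j(u_i^{(k-j+1)}-u_i^{(k-j)})+\omega_3f_i^{(k+1)}$ for $1\le i\le m-1$, $0\le k\le n-1$ (empty sum for $k=0$), with $u_i^{(0)}=\phi(x_i)$ for $0\le i\le m$ and $u_0^{(k)}=u_m^{(k)}=0$ for $1\le k\le n$. Local truncation errors: with $\psi_i^{(k)}=u(x_i,t_k)-u_i^{(k)}$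 for $0\le i\le m$, $0\le k\le n$, put $R_i^{(k+1)}=(L\psi)_i^{(k+1)}-\psi_i^{(k)}+\sum_{j=1}^{k}a_j(\psi_i^{(k-j+1)}-\psi_i^{(k-j)})$ for $1\le i\le m-1$, $0\le k\le n-1$. *)

(* Defs.v *)
From HB Require Import structures.
From mathcomp Require Import all_boot all_order all_algebra.
From mathcomp Require Import all_classical all_reals all_analysis.

Set Implicit Arguments.
Unset Strict Implicit.
Unset Printing Implicit Defensive.

Import Order.TTheory GRing.Theory Num.Theory.
Import numFieldNormedType.Exports.

Local Open Scope classical_set_scope.
Local Open Scope ring_scope.

(* Two-variable functions take the space variable first: [u x t]. Grid
   functions are [v i k], with [i] the space index and [k] the time level; only
   the values at [0 <= i <= m], [0 <= k <= n] are meaningful. *)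

Section FractionalDerivatives.
Context {R : realType}.
Implicit Types (theta z : R) (v : R -> R).

Definition Gamma z : R :=
  \int[lebesgue_measure]_(s in `]0, +oo[) (s `^ (z - 1) * expR (- s)).

Definition caputo_kernel alpha (w : R -> R) (t : R) : R -> R :=
  fun s => derive1 w s / (t - s) `^ alpha.

Definition caputo alpha (w : R -> R) (t : R) : R :=
  (Gamma (1 - alpha))^-1 *
  \int[lebesgue_measure]_(s in `]0, t[) caputo_kernel alpha w t s.

Definition caputo_defined alpha (w : R -> R) (t : R) : Prop :=
  (forall s, 0 < s < t -> derivable w s 1) /\
  (@lebesgue_measure R).-integrable `]0, t[
    (EFin \o caputo_kernel alpha w t).

(* The integer p with p - 1 < theta <= p (for theta > 0). *)
Definition rl_order theta : nat := `|Num.ceil theta|%N.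

Definition rl_left_kernel theta v (x : R) : R -> R :=
  fun s => v s / (x - s) `^ (theta - (rl_order theta)%:R + 1).

Definition rl_right_kernel theta v (x : R) : R -> R :=
  fun s => v s / (s - x) `^ (theta - (rl_order theta)%:R + 1).

(* The function whose p-th derivative, p = [rl_order theta], is the
   Riemann-Liouville derivative up to a constant; for integer theta the
   fractional integral degenerates and is replaced by [v] itself. *)
Definition rl_left_pre theta (a : R) v : R -> R :=
  if theta == (rl_order theta)%:R then v
  else fun x => \int[lebesgue_measure]_(s in `]a, x[) rl_left_kernel theta v x s.

Definition rl_right_pre theta (b : R) v : R -> R :=
  if theta == (rl_order theta)%:R then v
  else fun x => \int[lebesgue_measure]_(s in `]x, b[) rl_right_kernel theta v x s.

Definition rl_const theta : R :=
  if theta == (rl_order theta)%:R then 1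
  else (Gamma ((rl_order theta)%:R - theta))^-1.

Definition rl_left theta (a : R) v (x : R) : R :=
  rl_const theta * derive1n (rl_order theta) (rl_left_pre theta a v) x.

Definition rl_right theta (b : R) v (x : R) : R :=
  (- 1) ^+ rl_order theta * rl_const theta *
  derive1n (rl_order theta) (rl_right_pre theta b v) x.

Definition n_derivable_on (p : nat) (a b : R) (F : R -> R) : Prop :=
  forall k, (k < p)%N -> forall x, a < x < b -> derivable (derive1n k F) x 1.

Definition rl_left_defined theta (a b : R) v : Prop :=
  (theta != (rl_order theta)%:R ->
   forall x, a < x < b ->
     (@lebesgue_measure R).-integrable `]a, x[
       (EFin \o rl_left_kernel theta v x)) /\
  n_derivable_on (rl_order theta) a b (rl_left_pre theta a v).

Definition rl_right_defined theta (a b : R) v : Prop :=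
  (theta != (rl_order theta)%:R ->
   forall x, a < x < b ->
     (@lebesgue_measure R).-integrable `]x, b[
       (EFin \o rl_right_kernel theta v x)) /\
  n_derivable_on (rl_order theta) a b (rl_right_pre theta b v).

End FractionalDerivatives.

Record fade_data (R : realType) := FadeData {
  alpha : R; beta : R; gamma : R;
  xa : R; xb : R; tT : R;
  dp : R -> R -> R; dm : R -> R -> R;
  ep : R -> R -> R; em : R -> R -> R;
  src : R -> R -> R;
  phi : R -> R }.

Section Problem.
Context {R : realType} (P : fade_data R).
Local Notation a := (xa P).
Local Notation b := (xb P).
Local Notation T := (tT P).

(* Since derivatives and integrals are total operators, that the terms of the
   equation make sense is part of being a solution. *)
Definition fade_defined (u : R -> R -> R) : Prop :=
  (forall x t, a < x < b -> 0 < t <= T -> caputo_defined (alpha P) (u x) t) /\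
  (forall t, 0 < t <= T ->
    [/\ rl_left_defined (beta P) a b (u^~ t),
        rl_right_defined (beta P) a b (u^~ t),
        rl_left_defined (gamma P) a b (u^~ t) &
        rl_right_defined (gamma P) a b (u^~ t)]).

Definition fade_equation (u : R -> R -> R) : Prop :=
  forall x t, a < x < b -> 0 < t <= T ->
    caputo (alpha P) (u x) t =
      - dp P x t * rl_left (beta P) a (u^~ t) x
      - dm P x t * rl_right (beta P) b (u^~ t) x
      + ep P x t * rl_left (gamma P) a (u^~ t) x
      + em P x t * rl_right (gamma P) b (u^~ t) x
      + src P x t.

Definition exact_solution (u : R -> R -> R) : Prop :=
  [/\ fade_defined u,
      fade_equation u,
      forall x, a <= x <= b -> u x 0 = phi P x &
      forall t, 0 < t <= T -> u a t = 0 /\ u b t = 0].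

Definition hstep (m : nat) : R := (b - a) / m%:R.
Definition tau (n : nat) : R := T / n%:R.
Definition xnode (m i : nat) : R := a + i%:R * hstep m.
Definition tnode (n j : nat) : R := j%:R * tau n.

Definition acoef (j : nat) : R :=
  j.+1%:R `^ (1 - alpha P) - j%:R `^ (1 - alpha P).

Definition gcoef (theta : R) (j : nat) : R :=
  (- 1) ^+ j / j`!%:R * \prod_(0 <= l < j) (theta - l%:R).

Definition omega3 (n : nat) : R := Gamma (2 - alpha P) * tau n `^ alpha P.
Definition omega1 (m n : nat) : R := omega3 n / hstep m `^ beta P.
Definition omega2 (m n : nat) : R := omega3 n / hstep m `^ gamma P.

(* [Lop m n v i k] is (Lv)_i^(k), so it is used at time level k.+1. *)
Definition Lop (m n : nat) (v : nat -> nat -> R) (i k : nat) : R :=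
  let x := xnode m i in let t := tnode n k in
  v i k
  + omega1 m n *
    (dp P x t * (\sum_(0 <= j < i.+1) gcoef (beta P) j * v (i - j)%N k)
     + dm P x t * (\sum_(0 <= j < (m - i).+1) gcoef (beta P) j * v (i + j)%N k))
  - omega2 m n *
    (ep P x t * (\sum_(0 <= j < i.+2) gcoef (gamma P) j * v (i.+1 - j)%N k)
     + em P x t *
       (\sum_(0 <= j < (m - i).+2) gcoef (gamma P) j * v (i + j - 1)%N k)).

Definition memory (v : nat -> nat -> R) (i k : nat) : R :=
  \sum_(1 <= j < k.+1) acoef j * (v i (k - j).+1 - v i (k - j)%N).

Definition numerical_solution (m n : nat) (v : nat -> nat -> R) : Prop :=
  [/\ forall i k, (1 <= i <= m - 1)%N -> (k <= n - 1)%N ->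
        Lop m n v i k.+1 =
          v i k - memory v i k + omega3 n * src P (xnode m i) (tnode n k.+1),
      forall i, (i <= m)%N -> v i 0%N = phi P (xnode m i) &
      forall k, (1 <= k <= n)%N -> v 0%N k = 0 /\ v m k = 0].

Definition grid_error (m n : nat) (u : R -> R -> R) (v : nat -> nat -> R)
    (i k : nat) : R :=
  u (xnode m i) (tnode n k) - v i k.

(* R_i^(k+1) *)
Definition truncation_error (m n : nat) (u : R -> R -> R)
    (v : nat -> nat -> R) (i k : nat) : R :=
  let psi := grid_error m n u v in
  Lop m n psi i k.+1 - psi i k + memory psi i k.

End Problem.

(* Main.v *)
Require Import Defs.
From HB Require Import structures.
From mathcomp Require Import all_boot all_order all_algebra.
From mathcomp Require Import all_classical all_reals all_analysis.
From mathcomp Require Import ring lra.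
Import Order.TTheory GRing.Theory Num.Theory.
Import numFieldNormedType.Exports.
Local Open Scope ring_scope.

(** The grid error psi vanishes at time 0 and on the boundary, and the scheme
    applied to it leaves exactly the truncation error. The estimate is therefore a
    stability bound for the scheme in the maximum norm, followed by a bound on the
    growth of the stability constant; of the exact solution only its initial and
    boundary values matter, its regularity being contained in the assumption on
    the truncation error.

    Space. The Grünwald coefficients of an order in [0, 1] are nonpositive apart
    from g_0, with nonnegative partial sums, and those of an order in [1, 2] are
    nonnegative apart from g_1, with nonpositive partial sums from two terms on:
    [gcoef_le0], [gcoef_ge0], [sum_gcoef]. So the spatial part of the operator L is
    a diagonally dominant matrix with nonpositive off-diagonal entries. The
    advection stencil has its dominant entry at j = 0, the diffusion stencil,
    being shifted by one node, at j = 1. Where |psi| is largest in space,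
    |psi| <= |L psi| follows ([norm_le_Lop]).

    Time. Summation by parts ([memory_by_parts]) writes the history as a convex
    combination of the earlier levels, with weights a_j - a_(j+1) and a_k, because
    a_j decreases from a_0 = 1. Induction on k gives |psi^(k+1)| <= M / a_k when
    the truncation error is at most M ([scheme_stability]).

    Rate. From a_k >= (1 - alpha) (k+1)^(-alpha) ([acoef_lower]), with
    M = C0 (tau^2 + tau^alpha h) = C0 tau^alpha (tau^(2 - alpha) + h),
    the bound M / a_k is at most
    C0 / (1 - alpha) t_(k+1)^alpha (tau^(2 - alpha) + h), and t_(k+1) <= T. *)

(** * Grünwald coefficients *)

Lemma gcoef0 (R : realType) (theta : R) : gcoef theta 0 = 1.
Proof. by rewrite /gcoef big_geq // fact0 invr1 !mulr1. Qed.

Lemma gcoefS (R : realType) (theta : R) (j : nat) :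
  gcoef theta j.+1 = gcoef theta j * (j%:R - theta) / j.+1%:R.
Proof.
rewrite /gcoef big_nat_recr //= factS natrM exprS.
by field; rewrite nat1r !pnatr_eq0 -!lt0n fact_gt0.
Qed.

(** Lowering the order by one reduces the signs for orders in [1, 2] to those for
    orders in [0, 1], and these to the signs for nonpositive orders. *)
Lemma gcoefS_shift (R : realType) (theta : R) (j : nat) :
  gcoef theta j.+1 = - theta / j.+1%:R * gcoef (theta - 1) j.
Proof.
elim: j => [|j IHj]; first by rewrite gcoefS !gcoef0; field.
have j_ge0 : 0 <= j%:R :> R by [].
by rewrite gcoefS IHj gcoefS; field; rewrite !gt_eqF //; lra.
Qed.

(** The partial sums are the coefficients of (1 - z)^(theta - 1), since dividing
    the generating function (1 - z)^theta by 1 - z sums its coefficients. *)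
Lemma sum_gcoef (R : realType) (theta : R) (N : nat) :
  \sum_(0 <= j < N.+1) gcoef theta j = gcoef (theta - 1) N.
Proof.
elim: N => [|N IHN]; first by rewrite big_nat1 !gcoef0.
rewrite big_nat_recr //= IHN gcoefS_shift gcoefS.
have N_ge0 : 0 <= N%:R :> R by [].
by field; rewrite !gt_eqF //; lra.
Qed.

Lemma gcoef_ge0_nonpos (R : realType) (theta : R) (j : nat) :
  theta <= 0 -> 0 <= gcoef theta j.
Proof.
move=> theta_le0; elim: j => [|j IHj]; first by rewrite gcoef0.
rewrite gcoefS mulr_ge0 ?invr_ge0 // mulr_ge0 // subr_ge0.
exact: le_trans theta_le0 _.
Qed.

Lemma gcoef_le0 (R : realType) (theta : R) (j : nat) :
  0 <= theta <= 1 -> (0 < j)%N -> gcoef theta j <= 0.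
Proof.
case: j => // j /andP[theta_ge0 theta_le1] _; rewrite gcoefS_shift.
rewrite mulr_le0_ge0 ?gcoef_ge0_nonpos ?subr_le0 //.
by rewrite mulNr oppr_le0 mulr_ge0.
Qed.

Lemma gcoef_ge0 (R : realType) (theta : R) (j : nat) :
  1 <= theta <= 2 -> j != 1%N -> 0 <= gcoef theta j.
Proof.
case: j => [|[|j]] // /andP[theta_ge1 theta_le2] _; first by rewrite gcoef0.
rewrite gcoefS_shift mulr_le0 //.
  by rewrite mulNr oppr_le0 mulr_ge0 // (le_trans ler01).
by apply: gcoef_le0 => //; lra.
Qed.

(** * Auxiliary inequalities *)

(** A weighted sum of [w] with nonnegative total weight, in which only the
    weight of the largest value [w p] may be positive, is nonnegative as soon as
    [w p] is. *)
Lemma dominant_sum_ge0 (R : realDomainType) (g w : nat -> R) (N p : nat) :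
  (forall j, (j < N)%N -> j != p -> g j <= 0) ->
  0 <= \sum_(0 <= j < N) g j ->
  0 <= w p -> (forall j, (j < N)%N -> w j <= w p) ->
  0 <= \sum_(0 <= j < N) g j * w j.
Proof.
move=> g_le0 sg_ge0 wp_ge0 w_le.
apply: le_trans (mulr_ge0 sg_ge0 wp_ge0) _.
rewrite mulr_suml !big_nat; apply: ler_sum => j /= jN.
have [->//|jp] := eqVneq j p.
by rewrite ler_wnM2l ?g_le0 ?w_le.
Qed.

Lemma Gamma_ge0 (R : realType) (z : R) : 0 <= Gamma z.
Proof.
by apply: Rintegral_ge0 => x _; rewrite mulr_ge0 ?powR_ge0 ?expR_ge0.
Qed.

(** Tangent line at 1 of the concave function x |-> x^p, from Young's inequality
    applied to x^p and 1 with the conjugate exponents 1/p and 1/(1 - p). *)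
Lemma powR_le_tangent (R : realType) (p x : R) : 0 < p < 1 -> 0 <= x ->
  x `^ p <= 1 + p * (x - 1).
Proof.
move=> /andP[p_gt0 p_lt1] x_ge0.
have q_gt0 : 0 < 1 - p by rewrite subr_gt0.
have := @conjugate_powR R (x `^ p) 1 p^-1 (1 - p)^-1 (powR_ge0 _ _) ler01.
rewrite !invr_gt0 !invrK => /(_ p_gt0 q_gt0 _).
rewrite addrC subrK mulr1 -powRrM mulfV ?gt_eqF // powRr1 // powR1 => /(_ erefl).
by move=> /le_trans; apply; lra.
Qed.

(** * Grid and mesh ratios *)

Section Scheme.
Context {R : realType} (P : fade_data R).
Local Notation T := (tT P).

Lemma hstep_gt0 (m : nat) : xa P < xb P -> (0 < m)%N -> 0 < hstep P m.
Proof. by move=> ab m_gt0; rewrite divr_gt0 ?subr_gt0 ?ltr0n. Qed.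

Lemma tau_gt0 (n : nat) : 0 < T -> (0 < n)%N -> 0 < tau P n.
Proof. by move=> T_gt0 n_gt0; rewrite divr_gt0 ?ltr0n. Qed.

Lemma xnode_bounds (m i : nat) : xa P < xb P -> (0 < m)%N -> (i <= m)%N ->
  xa P <= xnode P m i <= xb P.
Proof.
move=> ab m_gt0 im; have h_gt0 := hstep_gt0 _ ab m_gt0.
have -> : xb P = xa P + m%:R * hstep P m.
  by rewrite /hstep; field; rewrite pnatr_eq0 -lt0n.
by rewrite lerDl lerD2l mulr_ge0 ?ler_pM2r ?ler_nat // ltW.
Qed.

Lemma xnode_left (m : nat) : xnode P m 0 = xa P.
Proof. by rewrite /xnode mul0r addr0. Qed.

Lemma xnode_right (m : nat) : (0 < m)%N -> xnode P m m = xb P.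
Proof. by move=> m_gt0; rewrite /xnode /hstep; field; rewrite pnatr_eq0 -lt0n. Qed.

Lemma tnode0 (n : nat) : tnode P n 0 = 0.
Proof. by rewrite /tnode mul0r. Qed.

Lemma tnode_bounds (n k : nat) : 0 < T -> (0 < n)%N -> (k <= n)%N ->
  0 <= tnode P n k <= T.
Proof.
move=> T_gt0 n_gt0 kn; have t_gt0 := tau_gt0 _ T_gt0 n_gt0.
have TE : T = n%:R * tau P n by rewrite /tau; field; rewrite pnatr_eq0 -lt0n.
by rewrite TE mulr_ge0 ?ler_pM2r ?ler_nat // ltW.
Qed.

Lemma omega3_ge0 (n : nat) : 0 <= omega3 P n.
Proof. by rewrite mulr_ge0 ?Gamma_ge0 ?powR_ge0. Qed.

Lemma omega1_ge0 (m n : nat) : 0 <= omega1 P m n.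
Proof. by rewrite divr_ge0 ?omega3_ge0 ?powR_ge0. Qed.

Lemma omega2_ge0 (m n : nat) : 0 <= omega2 P m n.
Proof. by rewrite divr_ge0 ?omega3_ge0 ?powR_ge0. Qed.

(** * The discrete maximum principle *)

Lemma LopZ (m n : nat) (c : R) (v : nat -> nat -> R) (i k : nat) :
  Lop P m n (fun i k => c * v i k) i k = c * Lop P m n v i k.
Proof.
have sumZ (g w : nat -> R) N : \sum_(0 <= j < N) g j * (c * w j) =
    c * \sum_(0 <= j < N) g j * w j.
  by rewrite mulr_sumr; apply: eq_bigr => j _; rewrite mulrCA.
by rewrite /Lop /= !sumZ; ring.
Qed.

(** At a nonnegative maximum in space the discrete advection sums are nonnegative
    and the discrete diffusion sums nonpositive, by the signs of the coefficients
    and of their partial sums; both therefore only increase L v. *)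
Lemma Lop_ge_max (m n i k : nat) (v : nat -> nat -> R) :
  0 <= beta P <= 1 -> 1 <= gamma P <= 2 ->
  let x := xnode P m i in let t := tnode P n k in
  0 <= dp P x t -> 0 <= dm P x t -> 0 <= ep P x t -> 0 <= em P x t ->
  (0 < i < m)%N -> 0 <= v i k -> (forall j, (j <= m)%N -> v j k <= v i k) ->
  v i k <= Lop P m n v i k.
Proof.
move=> hbeta hgamma x t dp_ge0 dm_ge0 ep_ge0 em_ge0 /andP[i_gt0 im] v_ge0 v_le.
have advection (w : nat -> R) N : w 0%N = v i k ->
    (forall j, (j < N.+1)%N -> w j <= v i k) ->
    0 <= \sum_(0 <= j < N.+1) gcoef (beta P) j * w j.
  move=> w0 w_le; apply: (dominant_sum_ge0 _ _ _ _ 0); rewrite ?w0 //.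
    by move=> j _ j0; rewrite gcoef_le0 // lt0n.
  by rewrite sum_gcoef gcoef_ge0_nonpos // subr_le0; case/andP: hbeta.
have diffusion (w : nat -> R) N : w 1%N = v i k ->
    (forall j, (j < N.+2)%N -> w j <= v i k) ->
    \sum_(0 <= j < N.+2) gcoef (gamma P) j * w j <= 0.
  move=> w1 w_le; rewrite -oppr_ge0 -sumrN.
  under eq_bigr do rewrite -mulNr.
  apply: (dominant_sum_ge0 _ (fun j => - gcoef _ j) _ _ 1); rewrite ?w1 //.
    by move=> j _ j1; rewrite oppr_le0 gcoef_ge0.
  by rewrite sumrN oppr_ge0 sum_gcoef gcoef_le0 //; lra.
rewrite /Lop /= -/x -/t -addrA lerDl subr_ge0.
apply: (@le_trans _ _ 0).
  rewrite mulr_ge0_le0 ?omega2_ge0 // -[leRHS]addr0.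
  apply: lerD; apply: mulr_ge0_le0 => //; apply: diffusion.
  - by rewrite subn1.
  - by move=> j ji; apply: v_le; rewrite (leq_trans (leq_subr _ _)).
  - by rewrite addnK.
  - case=> [|j] ji; apply: v_le; rewrite subn1 ?addn0 ?addnS /=.
      by rewrite (leq_trans (leq_pred _)) // ltnW.
    by rewrite -leq_subRL // ltnW.
rewrite mulr_ge0 ?omega1_ge0 // addr_ge0 // mulr_ge0 //; apply: advection.
- by rewrite subn0.
- by move=> j ji; apply: v_le; rewrite (leq_trans (leq_subr _ _)) ?(ltnW im).
- by rewrite addn0.
- by move=> j ji; apply: v_le; rewrite -leq_subRL ?(ltnW im).
Qed.

(** The same bound for a maximum of the modulus, of either sign. *)
Lemma norm_le_Lop (m n i k : nat) (v : nat -> nat -> R) :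
  0 <= beta P <= 1 -> 1 <= gamma P <= 2 ->
  let x := xnode P m i in let t := tnode P n k in
  0 <= dp P x t -> 0 <= dm P x t -> 0 <= ep P x t -> 0 <= em P x t ->
  (0 < i < m)%N -> (forall j, (j <= m)%N -> `|v j k| <= `|v i k|) ->
  `|v i k| <= `|Lop P m n v i k|.
Proof.
move=> hbeta hgamma x t dp_ge0 dm_ge0 ep_ge0 em_ge0 im v_le.
have sg_le (y : R) : Num.sg (v i k) * y <= `|y|.
  by apply: le_trans (ler_norm _) _; rewrite normrM normr_sg ler_piMl ?lern1 ?leq_b1.
apply: le_trans (sg_le _); rewrite -LopZ normrEsg.
apply: (Lop_ge_max m n i k (fun i k => _ * v i k)) => //=; rewrite -normrEsg //.
by move=> j jm; apply: le_trans (sg_le _) (v_le _ jm).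
Qed.

(** * Memory coefficients *)

Lemma acoef0 : alpha P < 1 -> acoef P 0 = 1.
Proof. by move=> a_lt1; rewrite /acoef powR1 powR0 ?subr0 // gt_eqF // subr_gt0. Qed.

(** The mean value bound k.+1^(1 - alpha) - k^(1 - alpha) >= (1 - alpha) k.+1^(-alpha),
    from the tangent inequality at the ratio k / k.+1. *)
Lemma acoef_lower (k : nat) : 0 < alpha P < 1 ->
  (1 - alpha P) / k.+1%:R `^ alpha P <= acoef P k.
Proof.
move=> /andP[a_gt0 a_lt1].
have k_gt0 : 0 < k.+1%:R :> R by rewrite ltr0n.
have kE : k%:R = k%:R / k.+1%:R * k.+1%:R :> R by rewrite divfK ?gt_eqF.
have p01 : 0 < 1 - alpha P < 1 by lra.
have tangent := powR_le_tangent _ (1 - alpha P) (k%:R / k.+1%:R) p01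
  (divr_ge0 (ler0n _ _) (ler0n _ _)).
rewrite /acoef lerBrDr kE powRM ?divr_ge0 //.
apply: le_trans (lerD (lexx _) (ler_wpM2r (powR_ge0 _ _) tangent)) _.
have -> : k.+1%:R `^ (1 - alpha P) = k.+1%:R / k.+1%:R `^ alpha P.
  by rewrite powRB ?powRr1 // gt_eqF // implybT.
have pw_gt0 : 0 < k.+1%:R `^ alpha P by rewrite powR_gt0.
rewrite le_eqVlt; apply/orP; left; apply/eqP.
by field; rewrite nat1r !gt_eqF.
Qed.

Lemma acoef_gt0 (k : nat) : 0 < alpha P < 1 -> 0 < acoef P k.
Proof.
move=> ha; apply: lt_le_trans (acoef_lower k ha).
by rewrite divr_gt0 ?powR_gt0 ?ltr0n // subr_gt0; case/andP: ha.
Qed.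

(** Concavity of x |-> x^(1 - alpha) at k, k.+1, k.+2: the tangent inequalities at
    k / k.+1 and k.+2 / k.+1 add up to 2. *)
Lemma acoef_decr (k : nat) : 0 < alpha P < 1 -> acoef P k.+1 <= acoef P k.
Proof.
move=> /andP[a_gt0 a_lt1]; set p := 1 - alpha P.
have hp : 0 < p < 1 by rewrite /p; lra.
have k_gt0 : 0 < k.+1%:R :> R by rewrite ltr0n.
have kE j : j%:R = j%:R / k.+1%:R * k.+1%:R :> R by rewrite divfK ?gt_eqF.
have jE j : j%:R `^ p = (j%:R / k.+1%:R) `^ p * k.+1%:R `^ p.
  by rewrite {1}kE powRM ?divr_ge0.
have tangent j := powR_le_tangent _ p (j%:R / k.+1%:R) hp
  (divr_ge0 (ler0n _ _) (ler0n _ _)).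
rewrite /acoef -/p lerBlDr addrAC lerBrDr (jE k.+2) (jE k) -mulrDl -mulr2n.
rewrite -[leRHS]mulr_natl ler_wpM2r ?powR_ge0 //.
apply: le_trans (lerD (tangent _) (tangent _)) _.
rewrite le_eqVlt; apply/orP; left; apply/eqP.
by field; rewrite nat1r gt_eqF.
Qed.

Lemma acoef_le (j k : nat) : 0 < alpha P < 1 -> (j <= k)%N ->
  acoef P k <= acoef P j.
Proof.
move=> ha; elim: k => [|k IHk]; first by rewrite leqn0 => /eqP->.
by rewrite leq_eqVlt => /predU1P[->//|/IHk]; apply/le_trans/acoef_decr.
Qed.

(** Summation by parts: the history enters with the nonnegative weights
    a_j - a_(j+1) and a_k, which add up to 1. *)
Lemma memory_by_parts (v : nat -> nat -> R) (i k : nat) : alpha P < 1 ->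
  v i k - memory P v i k =
  \sum_(0 <= j < k) (acoef P j - acoef P j.+1) * v i (k - j)%N
  + acoef P k * v i 0%N.
Proof.
move=> a_lt1; rewrite /memory.
have -> : \sum_(0 <= j < k) (acoef P j - acoef P j.+1) * v i (k - j)%N =
  \sum_(0 <= j < k) acoef P j * v i (k - j)%N
  - \sum_(0 <= j < k) acoef P j.+1 * v i (k - j)%N.
  by rewrite -sumrB; apply: eq_bigr => j _; rewrite mulrBl.
have -> : \sum_(1 <= j < k.+1) acoef P j * (v i (k - j).+1 - v i (k - j)%N) =
  \sum_(0 <= j < k) acoef P j.+1 * v i (k - j)%N
  - \sum_(1 <= j < k.+1) acoef P j * v i (k - j)%N.
  rewrite !big_add1 /= -sumrB !big_nat; apply: eq_bigr => j /= jk.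
  by rewrite mulrBr subnSK.
have : \sum_(0 <= j < k.+1) acoef P j * v i (k - j)%N =
   v i k + \sum_(1 <= j < k.+1) acoef P j * v i (k - j)%N.
  by rewrite big_ltn // acoef0 // mul1r subn0.
by rewrite big_nat_recr //= subnn; lra.
Qed.

(** * Stability of the scheme *)

(** A grid function that vanishes initially and on the boundary is bounded by a
    bound M on its residual divided by the last memory coefficient. In the induction, each
    earlier value is at most M / a_(k-1-j) <= M / a_k, the weights a_j - a_(j+1)
    add up to 1 - a_k, and M itself is a_k * (M / a_k). *)
Lemma scheme_stability (m n : nat) (v : nat -> nat -> R) (M : R) :
  0 < alpha P < 1 -> 0 <= beta P <= 1 -> 1 <= gamma P <= 2 ->
  (forall i k, (i <= m)%N -> (k <= n)%N ->
     let x := xnode P m i in let t := tnode P n k in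
     [/\ 0 <= dp P x t, 0 <= dm P x t, 0 <= ep P x t & 0 <= em P x t]) ->
  (forall i, (i <= m)%N -> v i 0%N = 0) ->
  (forall k, (k < n)%N -> v 0%N k.+1 = 0 /\ v m k.+1 = 0) ->
  (forall i k, (0 < i < m)%N -> (k < n)%N ->
     `|Lop P m n v i k.+1 - v i k + memory P v i k| <= M) ->
  0 <= M ->
  forall i k, (i <= m)%N -> (k < n)%N -> `|v i k.+1| <= M / acoef P k.
Proof.
move=> ha hbeta hgamma hcoef v_init v_bound v_res M_ge0 i k.
have a_lt1 : alpha P < 1 by case/andP: ha.
have a_gt0 j : 0 < acoef P j by apply: acoef_gt0.
elim/ltn_ind: k i => k IHk i im kn.
(* a node at which the modulus is maximal at the new time level *)
pose i0 := [arg max_(l > (ord0 : 'I_m.+1)) `|v l k.+1|]%O.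
have i0_max j : (j <= m)%N -> `|v j k.+1| <= `|v i0 k.+1|.
  rewrite /i0; case: arg_maxP => // l _ lmax jm.
  exact: (lmax (Ordinal (jm : (j < m.+1)%N))).
apply: le_trans (i0_max _ im) _.
have : (i0 <= m)%N by rewrite -ltnS.
move: (nat_of_ord i0) i0_max => {i0} l l_max lm.
have bound_ge0 : 0 <= M / acoef P k by rewrite divr_ge0 // ltW.
have [->|l_gt0] := posnP l; first by rewrite (v_bound k kn).1 normr0.
move: lm; rewrite leq_eqVlt => /predU1P[->|lm].
  by rewrite (v_bound k kn).2 normr0.
have [dp0 dm0 ep0 em0] := hcoef l k.+1 (ltnW lm) kn.
have lm2 : (0 < l < m)%N by rewrite l_gt0.
(* the maximum is attained at an interior node *)
apply: le_trans (norm_le_Lop _ _ _ _ _ hbeta hgamma dp0 dm0 ep0 em0 lm2 l_max) _.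
have -> : Lop P m n v l k.+1 = (Lop P m n v l k.+1 - v l k + memory P v l k)
   + (v l k - memory P v l k) by ring.
apply: le_trans (ler_normD _ _) _.
rewrite memory_by_parts // v_init 1?ltnW // mulr0 addr0.
have -> : M / acoef P k = M +
    \sum_(0 <= j < k) (acoef P j - acoef P j.+1) * (M / acoef P k).
  rewrite -mulr_suml.
  have -> : \sum_(0 <= j < k) (acoef P j - acoef P j.+1) = 1 - acoef P k.
    rewrite -(acoef0 a_lt1) -opprB -telescope_sumr // -sumrN.
    by apply: eq_bigr => j _; rewrite opprB.
  by field; rewrite gt_eqF.
apply: lerD; first exact: v_res.
apply: le_trans (ler_norm_sum _ _ _) _.
rewrite !big_nat; apply: ler_sum => j /= jk.
rewrite normrM ger0_norm ?subr_ge0 ?acoef_decr //.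
rewrite ler_wpM2l ?subr_ge0 ?acoef_decr //.
rewrite -[(k - j)%N]prednK ?subn_gt0 //.
have lt_k : ((k - j).-1 < k)%N by rewrite prednK ?subn_gt0 ?leq_subr.
apply: le_trans (IHk _ lt_k _ (ltnW lm) (ltn_trans lt_k kn)) _.
by rewrite ler_wpM2l // lef_pV2 ?posrE // acoef_le // ltnW.
Qed.

End Scheme.

Theorem corollary2p4 (R : realType) (P : fade_data R)
    (u : R -> R -> R) (U : nat -> nat -> nat -> nat -> R)
    (halpha : 0 < alpha P < 1)
    (hbeta : 0 < beta P <= 1)
    (hgamma : 1 < gamma P <= 2)
    (hab : xa P < xb P)
    (hT : 0 < tT P)
    (hcoef : forall x t, xa P <= x <= xb P -> 0 <= t <= tT P ->
       [/\ 0 <= dp P x t, 0 <= dm P x t, 0 <= ep P x t & 0 <= em P x t])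
    (hu : exact_solution P u)
    (hU : forall m n, (2 <= m)%N -> (1 <= n)%N ->
       numerical_solution P m n (U m n))
    (hR : exists2 C0 : R, 0 < C0 &
       forall m n i k, (2 <= m)%N -> (1 <= n)%N ->
         (1 <= i <= m - 1)%N -> (k <= n - 1)%N ->
         `|truncation_error P m n u (U m n) i k|
           <= C0 * (tau P n ^+ 2 + tau P n `^ alpha P * hstep P m)) :
  exists C : R,
    forall m n i k, (2 <= m)%N -> (1 <= n)%N ->
      (1 <= i <= m - 1)%N -> (1 <= k <= n)%N ->
      `|u (xnode P m i) (tnode P n k) - U m n i k|
        <= C * (tau P n `^ (2 - alpha P) + hstep P m).
Proof.
case: hR => C0 C0_gt0 {}hR; have [_ _ u_init u_bound] := hu.
have [a_gt0 a_lt1] := andP halpha.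
have q_gt0 : 0 < 1 - alpha P by rewrite subr_gt0.
exists (C0 * tT P `^ alpha P / (1 - alpha P)) => m n i [|k] // m2 n1.
move=> /andP[i1 im] /= kn.
have m_gt0 : (0 < m)%N by apply: leq_trans m2.
have im' : (i <= m)%N by apply: leq_trans im (leq_subr _ _).
have h_gt0 := hstep_gt0 P _ hab m_gt0.
have t_gt0 := tau_gt0 P _ hT n1.
have [_ U_init U_bound] := hU m n m2 n1.
set M := C0 * (tau P n ^+ 2 + tau P n `^ alpha P * hstep P m).
have M_ge0 : 0 <= M.
  rewrite mulr_ge0 ?(ltW C0_gt0) // addr_ge0 ?sqr_ge0 //.
  by rewrite mulr_ge0 ?powR_ge0 ?(ltW h_gt0).
have tnode_gt0 j : (j < n)%N -> 0 < tnode P n j.+1 <= tT P.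
  move=> jn; have /andP[_ ->] := tnode_bounds P _ _ hT n1 jn.
  by rewrite mulr_gt0 ?ltr0n.
have stab : `|grid_error P m n u (U m n) i k.+1| <= M / acoef P k.
  apply: (scheme_stability P m n) => //.
  - by case/andP: hbeta => /ltW -> ->.
  - by case/andP: hgamma => /ltW -> ->.
  - move=> i' k' im1 kn1; apply: hcoef; first exact: xnode_bounds.
    exact: tnode_bounds.
  - move=> i' im1; rewrite /grid_error tnode0 U_init // u_init ?subrr //.
    exact: xnode_bounds.
  - move=> k' kn1; have [U0 Um] := U_bound k'.+1 kn1.
    have [u0 um] := u_bound _ (tnode_gt0 _ kn1).
    by rewrite /grid_error xnode_left xnode_right // U0 Um u0 um !subr0.
  - move=> i' k' /andP[i1' im1] kn1; apply: hR => //.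
      by rewrite i1' -ltnS subn1 prednK.
    by rewrite -ltnS subn1 prednK.
apply: le_trans stab _.
have pw_gt0 : 0 < k.+1%:R `^ alpha P :> R by rewrite powR_gt0.
have stab2 : M / acoef P k <= M * (k.+1%:R `^ alpha P / (1 - alpha P)).
  rewrite ler_wpM2l // -[leRHS]invrK lef_pV2 ?posrE ?acoef_gt0 //; first last.
    by rewrite invr_gt0 divr_gt0.
  by rewrite invf_div; apply: acoef_lower.
apply: le_trans stab2 _.
(* tau^2 = tau^(2 - alpha) * tau^alpha, so that the factor tau^alpha turns
   (k+1)^alpha into a power of the bounded time t_(k+1) *)
have ME : M = C0 * (tau P n `^ alpha P) * (tau P n `^ (2 - alpha P) + hstep P m).
  rewrite /M -(powR_mulrn 2 (ltW t_gt0)).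
  have -> : 2%:R = alpha P + (2 - alpha P) :> R by ring.
  rewrite powRD ?(gt_eqF t_gt0) ?implybT //.
  have -> : alpha P + (2 - alpha P) - alpha P = 2 - alpha P by ring.
  by ring.
have timeE : k.+1%:R `^ alpha P * tau P n `^ alpha P <= tT P `^ alpha P.
  rewrite -powRM ?(ltW t_gt0) //; have /andP[t0 t1] := tnode_gt0 _ kn.
  by apply: ge0_ler_powR; rewrite ?nnegrE ?(ltW a_gt0) ?(ltW t0) ?(ltW hT).
have -> : M * (k.+1%:R `^ alpha P / (1 - alpha P)) =
   k.+1%:R `^ alpha P * tau P n `^ alpha P *
     (C0 / (1 - alpha P) * (tau P n `^ (2 - alpha P) + hstep P m)).
  by rewrite ME; field; rewrite gt_eqF.
have -> : C0 * tT P `^ alpha P / (1 - alpha P) * (tau P n `^ (2 - alpha P) + hstep P m)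
   = tT P `^ alpha P * (C0 / (1 - alpha P) * (tau P n `^ (2 - alpha P) + hstep P m)).
  by ring.
rewrite ler_wpM2r // mulr_ge0 //.
  by rewrite divr_ge0 ?(ltW C0_gt0) ?(ltW q_gt0).
by rewrite addr_ge0 ?powR_ge0 ?(ltW h_gt0).
Qed.
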